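(* Let $\Gamma\in\{G,W,O\}$, let $[\Gamma,\mathbb{B}]$ be the corresponding invariant line, and assume $\nu_\Gamma>8$ (or $(\nu_\Gamma^-)^2/\nu_\Gamma>8$). Let $M$ be a state on the segment $(\mathcal{U},\mathbb{B}]$, i.e. $s_M\in(s_{\mathcal{U}},1]$. Then there are two states $\mathfrak{S},\mathcal{F}$ on the segment $[\Gamma,\mathcal{U})$ such that for any state $U$ on the invariant line with $s_U\in(s_{\mathcal{F}},s_{\mathfrak{S}})$ there is an undercompressive shock (for the identity viscosity matrix) between $U$ (left state) and $M$ (right state) with speed $\sigma(U;M)$. The state $\mathfrak{S}$ satisfies $$\sigma(\mathfrak{S};M)=\lambda_s(\mathfrak{S}),$$ and, for all $s_M\in(s_{\mathcal{U}},1]$, the state $\mathcal{F}$ satisfies $$\sigma(\mathcal{F};M)=\lambda_f(M),\qquad s_{\mathcal{F}}\in[s_{\mathbb{B}_2^*},s_{\mathcal{U}}),$$ where $\mathbb{B}_2^*$ is a state on the invariant line satisfying $\sigma(\mathbb{B}_2^*;\mathbb{B})=\lambda_f(\mathbb{B})$, for $\mathbb{B}\in\{D,E,B\}$.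
   Context: Model. Let $\mu_w,\mu_o,\mu_g>0$ be the viscosities of water, oil, gas. Saturations are $s_w,s_o,s_g\ge 0$ with $s_w+s_o+s_g=1$; the saturation triangle is $\Omega=\{(s_w,s_o): s_w,s_o\ge0,\ s_w+s_o\le1\}$, with vertices $W,O,G$ where $s_w=1$, $s_o=1$, $s_g=1$ respectively. The flux is $F=(f_w,f_o)$ with $f_i=(s_i^2/\mu_i)/(\sum_{j\in\{w,o,g\}}s_j^2/\mu_j)$, and the system is $U_t+F(U)_x=0$, $U=(s_w,s_o)^T$. Denote by $\lambda_s(U)\le\lambda_f(U)$ the (slow and fast) eigenvalues of $DF(U)$. The umbilic point, where $\lambda_s=\lambda_f$, is $\mathcal{U}$ with $(s_w,s_o,s_g)=(\mu_w,\mu_o,\mu_g)/(\mu_w+\mu_o+\mu_g)$. Invariant lines. For $\Gamma\in\{G,W,O\}$ let $\gamma$ be the corresponding phase ($g,w,o$) and $\alpha,\beta$ the other two phases. Put $\nu_\Gamma=(\mu_\alpha+\mu_\beta)/\mu_\gamma$ and $\nu_\Gamma^-=(\mu_\alpha-\mu_\beta)/\mu_\gamma$. The invariant line $[\Gamma,\mathbb{B}]$ is the set of states with $s_\alpha/\mu_\alpha=s_\beta/\mu_\beta$; it is parametrized by the effective saturation $s=s_\alpha+s_\beta\in[0,1]$, with $s=0$ at the vertex $\Gamma$ and $s=1$ at the point $\mathbb{B}$ on the opposite edge ($\mathbb{B}$ is named $D,E,B$ for $\Gamma=G,W,O$). For a state $M$ on this line, $s_M$ denotes its effective saturation; $s_{\mathcal{U}}=\nu_\Gamma/(1+\nu_\Gamma)$.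 Intervals such as $(\mathcal{U},\mathbb{B}]$ denote segments of the line. With $E(s)=s^2+\nu_\Gamma(1-s)^2$, the eigenvalues of $DF$ along the line are $\lambda_a(s)=2s/E(s)$ and $\lambda_b(s)=2\nu_\Gamma s(1-s)/E(s)^2$, and $\lambda_s=\min\{\lambda_a,\lambda_b\}$, $\lambda_f=\max\{\lambda_a,\lambda_b\}$. The Rankine-Hugoniot speed $\sigma(M;N)$ between two states of the line (i.e. $F(N)-F(M)=\sigma(N-M)$) is $\sigma(M;N)=\nu_\Gamma(s_M+s_N-2s_Ms_N)/(E(s_M)E(s_N))$. Undercompressive shock (identity viscosity matrix). An undercompressive shock from left state $U^-$ to right state $U^+$ with speed $\sigma$ is a discontinuity satisfying $F(U^+)-F(U^-)=\sigma(U^+-U^-)$, for which $\lambda_s(U^\pm)<\sigma<\lambda_f(U^\pm)$ (so that $U^-$, $U^+$ are saddles of the ODE below), and having a viscous profile, i.e. there is an orbit of $\dot U=F(U)-F(U^-)-\sigma(U-U^-)$ going from $U^-$ (as time $\to-\infty$) to $U^+$ (as time $\to+\infty$). *)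

(* Defs.v *)
From Stdlib Require Import Reals Lra.
From Coquelicot Require Import Coquelicot.
Open Scope R_scope.

(** * Three-phase flow with quadratic permeabilities (Stdlib reals, Coquelicot) *)

(** A phase [c] also names the vertex of the saturation triangle at which only
    that phase is present: [gas], [water], [oil] stand for G, W, O. *)
Inductive phase := water | oil | gas.

(** The pair (s_w, s_o). *)
Definition state : Type := (R * R)%type.

Definition sat (U : state) (i : phase) : R :=
  match i with
  | water => fst U
  | oil => snd U
  | gas => 1 - fst U - snd U
  end.

Definition in_triangle (U : state) : Prop := forall i, 0 <= sat U i.

(** The three squares never vanish together, so this rational function is
    smooth on the whole plane and partial derivatives may be taken two-sided
    even at the boundary of the triangle. *)
Definition flux (mu : phase -> R) (i : phase) (U : state) : R :=
  (sat U i ^ 2 / mu i) /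
  (sat U water ^ 2 / mu water + sat U oil ^ 2 / mu oil + sat U gas ^ 2 / mu gas).

Definition d_w (f : state -> R) (U : state) : R :=
  Derive (fun x => f (x, snd U)) (fst U).
Definition d_o (f : state -> R) (U : state) : R :=
  Derive (fun y => f (fst U, y)) (snd U).

(** Trace, determinant and characteristic discriminant of the Jacobian DF(U),
    F = (f_w, f_o). *)
Definition trDF (mu : phase -> R) (U : state) : R :=
  d_w (flux mu water) U + d_o (flux mu oil) U.
Definition detDF (mu : phase -> R) (U : state) : R :=
  d_w (flux mu water) U * d_o (flux mu oil) U
  - d_o (flux mu water) U * d_w (flux mu oil) U.
Definition discDF (mu : phase -> R) (U : state) : R :=
  trDF mu U ^ 2 - 4 * detDF mu U.

(** Slow and fast eigenvalues of DF(U); see [eigenvalue_DFP]. *)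
Definition lambda_s (mu : phase -> R) (U : state) : R :=
  (trDF mu U - sqrt (discDF mu U)) / 2.
Definition lambda_f (mu : phase -> R) (U : state) : R :=
  (trDF mu U + sqrt (discDF mu U)) / 2.

Definition eigenvalue_DF (mu : phase -> R) (U : state) (l : R) : Prop :=
  exists v w : R, (v <> 0 \/ w <> 0) /\
    d_w (flux mu water) U * v + d_o (flux mu water) U * w = l * v /\
    d_w (flux mu oil) U * v + d_o (flux mu oil) U * w = l * w.

Lemma eigenvalue_DFP mu U l : 0 <= discDF mu U ->
  (eigenvalue_DF mu U l <-> l = lambda_s mu U \/ l = lambda_f mu U).
Proof.
  intros Hd.
  assert (Hc : (l - lambda_s mu U) * (l - lambda_f mu U)
               = l ^ 2 - trDF mu U * l + detDF mu U).
  { unfold lambda_s, lambda_f.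
    pose proof (sqrt_sqrt _ Hd) as Hs. unfold discDF in Hs at 3. nra. }
  unfold eigenvalue_DF. revert Hc. unfold trDF, detDF.
  generalize (lambda_s mu U) (lambda_f mu U) (d_w (flux mu water) U)
    (d_o (flux mu water) U) (d_w (flux mu oil) U) (d_o (flux mu oil) U).
  intros ls lf a b c d Hc. split.
  - intros (v & w & Hv & H1 & H2).
    assert (H0 : (l - ls) * (l - lf) = 0).
    { rewrite Hc. destruct Hv as [Hv | Hv]; apply (Rmult_eq_reg_r _ _ _) with (2 := Hv).
      - transitivity (b * (l * w - (c * v + d * w)) - (d - l) * (l * v - (a * v + b * w)));
          [ring | rewrite H1, H2; ring].
      - transitivity (c * (l * v - (a * v + b * w)) - (a - l) * (l * w - (c * v + d * w)));
          [ring | rewrite H1, H2; ring]. }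
    destruct (Rmult_integral _ _ H0); [left | right]; lra.
  - intros Hl.
    assert (H0 : l ^ 2 - (a + d) * l + (a * d - b * c) = 0).
    { rewrite <- Hc. destruct Hl; subst; ring. }
    destruct (Req_dec b 0) as [Hb | Hb].
    + destruct (Req_dec (l - d) 0) as [Hld | Hld].
      * exists 0, 1. repeat split; try lra; rewrite ?Hb; nra.
      * exists (l - d), c. repeat split; try (left; assumption); subst b; nra.
    + exists b, (l - a). repeat split; try (left; assumption); nra.
Qed.

(** The two phases other than [c]. *)
Definition phase_a (c : phase) : phase :=
  match c with gas => water | water => oil | oil => water end.
Definition phase_b (c : phase) : phase :=
  match c with gas => oil | water => gas | oil => gas end.

Definition nu (mu : phase -> R) (c : phase) : R :=
  (mu (phase_a c) + mu (phase_b c)) / mu c.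
Definition nu_minus (mu : phase -> R) (c : phase) : R :=
  (mu (phase_a c) - mu (phase_b c)) / mu c.

Definition on_line (mu : phase -> R) (c : phase) (U : state) : Prop :=
  in_triangle U /\
  sat U (phase_a c) / mu (phase_a c) = sat U (phase_b c) / mu (phase_b c).

(** Effective saturation. *)
Definition eff (c : phase) (U : state) : R := sat U (phase_a c) + sat U (phase_b c).

Definition umbilic (mu : phase -> R) : state :=
  (mu water / (mu water + mu oil + mu gas),
   mu oil / (mu water + mu oil + mu gas)).

(** The end point of the invariant line on the edge opposite to the vertex
    (D, E, B for the vertices G, W, O). *)
Definition end_sat (mu : phase -> R) (c i : phase) : R :=
  match c, i with
  | water, water | oil, oil | gas, gas => 0
  | _, _ => mu i / (mu (phase_a c) + mu (phase_b c))
  end.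
Definition end_point (mu : phase -> R) (c : phase) : state :=
  (end_sat mu c water, end_sat mu c oil).

Definition E_line (mu : phase -> R) (c : phase) (s : R) : R :=
  s ^ 2 + nu mu c * (1 - s) ^ 2.

(** Rankine-Hugoniot speed between two states of the invariant line;
    see [rh_speedP]. *)
Definition rh_speed (mu : phase -> R) (c : phase) (M N : state) : R :=
  nu mu c * (eff c M + eff c N - 2 * eff c M * eff c N) /
  (E_line mu c (eff c M) * E_line mu c (eff c N)).

Definition rankine_hugoniot (mu : phase -> R) (Um Up : state) (sg : R) : Prop :=
  flux mu water Up - flux mu water Um = sg * (fst Up - fst Um) /\
  flux mu oil Up - flux mu oil Um = sg * (snd Up - snd Um).

(** Orbit, inside the saturation triangle, of
    dU/dt = F(U) - F(U-) - sg (U - U-)  going from U- to U+. *)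
Definition viscous_profile (mu : phase -> R) (Um Up : state) (sg : R) : Prop :=
  exists u v : R -> R,
    (forall t, in_triangle (u t, v t)) /\
    (forall t, is_derive u t
       (flux mu water (u t, v t) - flux mu water Um - sg * (u t - fst Um))) /\
    (forall t, is_derive v t
       (flux mu oil (u t, v t) - flux mu oil Um - sg * (v t - snd Um))) /\
    is_lim u m_infty (fst Um) /\ is_lim v m_infty (snd Um) /\
    is_lim u p_infty (fst Up) /\ is_lim v p_infty (snd Up).

Definition undercompressive_shock (mu : phase -> R) (Um Up : state) (sg : R) : Prop :=
  rankine_hugoniot mu Um Up sg /\
  lambda_s mu Um < sg < lambda_f mu Um /\
  lambda_s mu Up < sg < lambda_f mu Up /\
  viscous_profile mu Um Up sg.

Lemma flux_line mu c U : (forall i, 0 < mu i) -> on_line mu c U ->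
  flux mu c U = nu mu c * (1 - eff c U) ^ 2 / E_line mu c (eff c U) /\
  (forall i, i = phase_a c \/ i = phase_b c ->
     sat U i = eff c U * (mu i / (mu (phase_a c) + mu (phase_b c))) /\
     flux mu i U = eff c U ^ 2 / E_line mu c (eff c U)
                   * (mu i / (mu (phase_a c) + mu (phase_b c)))).
Proof.
  intros Hmu [_ HU].
  pose proof (Hmu water) as Hw. pose proof (Hmu oil) as Ho. pose proof (Hmu gas) as Hg.
  assert (Hab : 0 < mu (phase_a c) + mu (phase_b c))
    by (pose proof (Hmu (phase_a c)); pose proof (Hmu (phase_b c)); lra).
  assert (Ha : sat U (phase_a c)
               = eff c U * (mu (phase_a c) / (mu (phase_a c) + mu (phase_b c)))).
  { unfold eff. pose proof (Hmu (phase_a c)). pose proof (Hmu (phase_b c)).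
    replace (sat U (phase_a c)) with
      (sat U (phase_b c) / mu (phase_b c) * mu (phase_a c))
      by (rewrite <- HU; field; lra).
    field; lra. }
  assert (Hb : sat U (phase_b c)
               = eff c U * (mu (phase_b c) / (mu (phase_a c) + mu (phase_b c)))).
  { replace (sat U (phase_b c)) with (eff c U - sat U (phase_a c)) by (unfold eff; ring).
    rewrite Ha. field; lra. }
  assert (Hc : sat U c = 1 - eff c U) by (destruct c; unfold eff; simpl; ring).
  assert (HE : 0 < E_line mu c (eff c U)).
  { unfold E_line. assert (0 < nu mu c) by (apply Rdiv_lt_0_compat; auto).
    destruct (Req_dec (eff c U) 0) as [H0 | H0]; [rewrite H0; nra |].
    assert (0 < eff c U ^ 2) by (apply pow2_gt_0; auto).
    pose proof (pow2_ge_0 (1 - eff c U)). nra. }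
  assert (HD : sat U water ^ 2 / mu water + sat U oil ^ 2 / mu oil + sat U gas ^ 2 / mu gas
               = E_line mu c (eff c U) / (mu (phase_a c) + mu (phase_b c))).
  { unfold E_line, nu.
    transitivity (sat U (phase_a c) ^ 2 / mu (phase_a c)
      + sat U (phase_b c) ^ 2 / mu (phase_b c) + sat U c ^ 2 / mu c);
      [destruct c; simpl; ring |].
    rewrite Ha, Hb, Hc. pose proof (Hmu (phase_a c)). pose proof (Hmu (phase_b c)).
    pose proof (Hmu c). field; lra. }
  unfold flux; rewrite HD. split.
  - rewrite Hc. unfold nu. pose proof (Hmu c). field. lra.
  - intros i [-> | ->]; [rewrite Ha | rewrite Hb]; split; trivial;
      [pose proof (Hmu (phase_a c)) | pose proof (Hmu (phase_b c))]; field; lra.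
Qed.

Lemma rh_speedP mu c M N : (forall i, 0 < mu i) -> on_line mu c M -> on_line mu c N ->
  rankine_hugoniot mu M N (rh_speed mu c M N).
Proof.
  intros Hmu HM HN.
  destruct (flux_line mu c M Hmu HM) as [Mc Mi].
  destruct (flux_line mu c N Hmu HN) as [Nc Ni].
  assert (Hn : 0 < nu mu c).
  { pose proof (Hmu (phase_a c)). pose proof (Hmu (phase_b c)).
    apply Rdiv_lt_0_compat; auto; lra. }
  assert (HE : forall s, 0 < E_line mu c s).
  { intros s. unfold E_line. destruct (Req_dec s 0) as [H0 | H0]; [rewrite H0; nra |].
    assert (0 < s ^ 2) by (apply pow2_gt_0; auto).
    pose proof (pow2_ge_0 (1 - s)). nra. }
  pose proof (HE (eff c M)) as EM. pose proof (HE (eff c N)) as EN.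
  assert (H : forall i, flux mu i N - flux mu i M
                        = rh_speed mu c M N * (sat N i - sat M i)).
  { intros i.
    assert (Hi : i = c \/ i = phase_a c \/ i = phase_b c) by (destruct c, i; simpl; auto).
    destruct Hi as [-> | Hi].
    - assert (HcM : sat M c = 1 - eff c M) by (destruct c; unfold eff; simpl; ring).
      assert (HcN : sat N c = 1 - eff c N) by (destruct c; unfold eff; simpl; ring).
      rewrite Mc, Nc, HcM, HcN. unfold rh_speed. unfold E_line in *. field; lra.
    - destruct (Mi i Hi) as [-> ->]. destruct (Ni i Hi) as [-> ->].
      unfold rh_speed. pose proof (Hmu (phase_a c)). pose proof (Hmu (phase_b c)).
      unfold E_line in *. field; lra. }
  split; [exact (H water) | exact (H oil)].
Qed.

Lemma end_point_on_line mu c : (forall i, 0 < mu i) ->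
  on_line mu c (end_point mu c) /\ eff c (end_point mu c) = 1.
Proof.
  intros Hmu. pose proof (Hmu water). pose proof (Hmu oil). pose proof (Hmu gas).
  assert (Hp : forall x y, 0 < x -> 0 < y -> 0 < x / (x + y) /\ 0 < x / (y + x))
    by (intros; split; apply Rdiv_lt_0_compat; lra).
  pose proof (Hp (mu water) (mu oil)). pose proof (Hp (mu oil) (mu water)).
  pose proof (Hp (mu water) (mu gas)). pose proof (Hp (mu gas) (mu water)).
  pose proof (Hp (mu oil) (mu gas)). pose proof (Hp (mu gas) (mu oil)).
  assert (Hone : forall x y, 0 < x -> 0 < y -> x / (x + y) + y / (x + y) = 1)
    by (intros; field; lra).
  pose proof (Hone (mu water) (mu oil)). pose proof (Hone (mu oil) (mu gas)).
  pose proof (Hone (mu water) (mu gas)).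
  split; [split |].
  - intros i. destruct c, i; simpl; lra.
  - destruct c; simpl; field; lra.
  - destruct c; unfold eff; simpl; lra.
Qed.

(* Main.v *)
Require Import Defs.
From Stdlib Require Import Reals Ranalysis5 Lra.
From Coquelicot Require Import Coquelicot.
Open Scope R_scope.

(** On the invariant line everything is a rational function of the effective
    saturation, and once the speeds are multiplied by [1 + nu] the viscosities
    enter only through the saturation [w = nu / (1 + nu)] of the umbilic point: the
    hypothesis on [nu] becomes [8 / 9 < w < 1] (the second alternative implies
    the first, because |nu_minus| <= nu).  Write [u] and [m] for the
    saturations of the left and right states, u < w < m.  One eigenvalue of DF
    belongs to the direction of the line ([lam_along]), the other is transverse
    to it ([lam_across]); they cross at [w], so that the transverse one is slow
    at [u] and fast at [m].  The four inequalities between the shock speed and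
    the eigenvalues thereby become polynomial inequalities.

    - Speed above [lam_across] at [u] is linear in [u]: it says that [u] is
      below [slow_contact], the saturation of the state S.
    - Speed below [lam_across] at [m] is the positivity of a quadratic
      [fast_poly] in [u].  For w > 8/9 it has two real roots, both below [w];
      the state F is the larger one, [fast_contact].
    - Speed below [lam_along] at [u], or above [lam_along] at [m], says that the
      graph of the flux lies locally above its chord.  The difference between
      flux and chord is, up to a positive factor, (s - u) (m - s) times
      [chord_gap w u s m], which is affine and increasing in [s]; so everything
      follows from [chord_gap w u u m > 0], and this is a consequence of
      [fast_poly w m u > 0] for [u] to the right of the roots ([chord_gap_pos]).

    The same positivity gives the viscous profile: the line is invariant under
    the travelling wave equation, which on it reads s' = flux - chord, and the
    right side is positive strictly between [u] and [m].  The scalar orbit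
    joining two consecutive equilibria is [heteroclinic_orbit_exists].

    Finally [fast_poly w m / m] decreases when [1 / m] grows, so a root of
    [fast_poly w 1] cannot exceed the larger root of [fast_poly w m]; this is
    the comparison with the states B2. *)

(** * Scalar orbits between consecutive equilibria *)

(** Inverting the time function [T x], the integral of [1 / h] from 0 to [x],
    solves the equation by separation of variables.  The upper bound on [h]
    makes [T] unbounded in both directions, so the solution is global and runs
    through all of R. *)
Lemma increasing_flow_exists (h : R -> R) (C : R) :
  (forall y, continuous h y) -> (forall y, 0 < h y <= C) ->
  exists y : R -> R, (forall t, is_derive y t (h (y t))) /\
    is_lim y m_infty m_infty /\ is_lim y p_infty p_infty.
Proof.
  intros Hc Hh.
  assert (HC : 0 < C) by (pose proof (Hh 0); lra).
  set (T := fun x => RInt (fun r => / h r) 0 x).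
  assert (Hci : forall x, continuous (fun r => / h r) x).
  { intros x. apply continuous_Rinv_comp; [apply Hc |].
    pose proof (Hh x); lra. }
  assert (HT : forall x, is_derive T x (/ h x)).
  { intros x. apply (is_derive_RInt (fun r => / h r) T 0); [| apply Hci].
    apply filter_forall. intros z. apply (RInt_correct (fun r => / h r)).
    apply (ex_RInt_continuous (fun r => / h r)). intros r _. apply Hci. }
  assert (Hgrow : forall x y, x < y -> (y - x) / C <= T y - T x).
  { intros x y Hxy.
    destruct (MVT_gen T x y (fun r => / h r)) as (z & _ & ->).
    - intros r _. apply HT.
    - intros r _. apply derivable_continuous_pt. exists (/ h r).
      apply is_derive_Reals, HT.
    - assert (/ C <= / h z) by (apply Rinv_le_contravar; apply Hh).
      unfold Rdiv. rewrite Rmult_comm. apply Rmult_le_compat_r; lra. }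
  assert (Hmono : forall x y, x < y -> T x < T y).
  { intros x y Hxy. pose proof (Hgrow x y Hxy).
    assert (0 < (y - x) / C) by (apply Rdiv_lt_0_compat; lra). lra. }
  assert (HT0 : T 0 = 0) by apply (RInt_point 0 (fun r => / h r)).
  assert (Hinv : forall t, {x | T x = t}).
  { intros t.
    assert (Hb : 0 < C * (Rabs t + 1)) by (pose proof (Rabs_pos t); nra).
    assert (H1 : Rabs t + 1 <= T (C * (Rabs t + 1))).
    { pose proof (Hgrow 0 _ Hb) as H. rewrite HT0 in H.
      replace ((C * (Rabs t + 1) - 0) / C) with (Rabs t + 1) in H by (field; lra). lra. }
    assert (H2 : T (- (C * (Rabs t + 1))) <= - (Rabs t + 1)).
    { pose proof (Hgrow (- (C * (Rabs t + 1))) 0 ltac:(lra)) as H. rewrite HT0 in H.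
      replace ((0 - - (C * (Rabs t + 1))) / C) with (Rabs t + 1) in H by (field; lra). lra. }
    pose proof (Rle_abs t). pose proof (Rle_abs (- t)). rewrite Rabs_Ropp in *.
    destruct (IVT_gen T (- (C * (Rabs t + 1))) (C * (Rabs t + 1)) t) as (x & _ & Hx).
    - intros r. apply derivable_continuous_pt. exists (/ h r).
      apply is_derive_Reals, HT.
    - rewrite Rmin_left, Rmax_right; lra.
    - exists x. exact Hx. }
  set (Y := fun t => proj1_sig (Hinv t)).
  assert (HTY : forall t, T (Y t) = t) by (intros t; apply (proj2_sig (Hinv t))).
  assert (HY : forall t x, T x < t -> x < Y t).
  { intros t x H. destruct (Rlt_le_dec x (Y t)) as [|[H1 | H1]]; trivial.
    - apply Hmono in H1. rewrite HTY in H1. lra.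
    - subst x. rewrite HTY in H. lra. }
  assert (HY' : forall t x, t < T x -> Y t < x).
  { intros t x H. destruct (Rlt_le_dec (Y t) x) as [|[H1 | H1]]; trivial.
    - apply Hmono in H1. rewrite HTY in H1. lra.
    - subst x. rewrite HTY in H. lra. }
  exists Y. split; [| split].
  - intros t. apply is_derive_Reals.
    assert (Prf : forall a, Y (t - 1) <= a <= Y (t + 1) -> derivable_pt T a).
    { intros a _. exists (/ h a). apply is_derive_Reals, HT. }
    assert (Hin : Y (t - 1) <= Y t <= Y (t + 1)).
    { split; left; [apply HY | apply HY]; rewrite HTY; lra. }
    assert (Hd : derive_pt T (Y t) (Prf (Y t) Hin) = / h (Y t)).
    { rewrite Derive_Reals. apply is_derive_unique, HT. }
    replace (h (Y t)) with (1 / derive_pt T (Y t) (Prf (Y t) Hin)).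
    2:{ rewrite Hd. field. pose proof (Hh (Y t)). lra. }
    apply derivable_pt_lim_recip_interv with (lb := t - 1) (ub := t + 1); try lra.
    + intros eps Heps. exists (Rmin (T (Y t + eps) - t) (t - T (Y t - eps))).
      pose proof (Hmono (Y t) (Y t + eps) ltac:(lra)) as H1.
      pose proof (Hmono (Y t - eps) (Y t) ltac:(lra)) as H2.
      rewrite HTY in H1, H2. split; [apply Rmin_glb_lt; lra |].
      intros x [_ Hx]. simpl in *. unfold R_dist in *.
      apply Rabs_def2 in Hx. destruct Hx as [Hx1 Hx2].
      pose proof (Rmin_l (T (Y t + eps) - t) (t - T (Y t - eps))).
      pose proof (Rmin_r (T (Y t + eps) - t) (t - T (Y t - eps))).
      pose proof (HY x (Y t - eps) ltac:(lra)).
      pose proof (HY' x (Y t + eps) ltac:(lra)).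
      apply Rabs_def1; lra.
    + intros x _. apply HTY.
    + rewrite Hd. apply Rinv_neq_0_compat. pose proof (Hh (Y t)). lra.
  - apply is_lim_spec. intros K. exists (T K). intros t Ht. apply HY', Ht.
  - apply is_lim_spec. intros K. exists (T K). intros t Ht. apply HY, Ht.
Qed.

(** The logistic function turns the interval (a, b) into the line and absorbs
    the two simple zeros of the vector field: in the new variable the velocity
    is [(b - a) * k], which is positive and bounded. *)
Lemma heteroclinic_orbit_exists (k : R -> R) (a b : R) :
  a < b -> (forall x, a <= x <= b -> continuous k x) ->
  (forall x, a <= x <= b -> 0 < k x) ->
  exists s : R -> R,
    (forall t, a < s t < b) /\
    (forall t, is_derive s t ((s t - a) * (b - s t) * k (s t))) /\
    is_lim s m_infty a /\ is_lim s p_infty b.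
Proof.
  intros Hab Hc Hk.
  set (p := fun y => (a + b * exp y) / (1 + exp y)).
  assert (Hp : forall y, a < p y < b).
  { intros y. unfold p. pose proof (exp_pos y).
    split; [apply Rlt_div_r | apply Rlt_div_l]; nra. }
  assert (Hdp : forall y, is_derive p y ((p y - a) * (b - p y) / (b - a))).
  { intros y. unfold p. pose proof (exp_pos y). auto_derive; [lra |]. field. lra. }
  destruct (continuity_ab_maj k a b ltac:(lra)) as (xM & HxM & _).
  { intros x Hx. apply continuity_pt_filterlim, Hc, Hx. }
  destruct (increasing_flow_exists (fun y => (b - a) * k (p y)) ((b - a) * k xM))
    as (y & Hy & Hm & Hpl).
  - intros y. apply (continuous_mult (fun _ => b - a) (fun y => k (p y)));
      [apply continuous_const |].
    apply (continuous_comp p k).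
    + apply (ex_derive_continuous p). eexists. apply Hdp.
    + apply Hc. pose proof (Hp y). lra.
  - intros y. pose proof (Hp y). split.
    + apply Rmult_lt_0_compat; [lra | apply Hk; lra].
    + apply Rmult_le_compat_l; [lra | apply HxM; lra].
  - exists (fun t => p (y t)). split; [| split; [| split]].
    + intros t. apply Hp.
    + intros t. pose proof (is_derive_comp p y t _ _ (Hdp (y t)) (Hy t)) as H.
      replace (_ * _ * _) with
        (scal ((b - a) * k (p (y t))) ((p (y t) - a) * (b - p (y t)) / (b - a)));
        [exact H |].
      unfold scal; simpl; unfold mult; simpl. field. lra.
    + apply (is_lim_comp p y m_infty a m_infty); [| exact Hm | exists 0; intros; discriminate].
      replace a with ((a + b * 0) / (1 + 0)) at 1 by field.
      apply (is_lim_comp_continuous exp (fun z => (a + b * z) / (1 + z)) m_infty 0).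
      * apply is_lim_exp_m.
      * apply (ex_derive_continuous (fun z => (a + b * z) / (1 + z))). auto_derive. lra.
    + apply (is_lim_comp p y p_infty b p_infty); [| exact Hpl | exists 0; intros; discriminate].
      replace b with ((a * 0 + b) / (0 + 1)) at 1 by field.
      apply (is_lim_ext (fun y => (a * exp (- y) + b) / (exp (- y) + 1))).
      { intros z. unfold p. rewrite exp_Ropp. pose proof (exp_pos z). field. lra. }
      apply (is_lim_comp_continuous (fun y => exp (- y)) (fun z => (a * z + b) / (z + 1)) p_infty 0).
      * apply (is_lim_comp exp Ropp p_infty 0 m_infty);
          [apply is_lim_exp_m | | exists 0; intros; discriminate].
        apply (is_lim_opp (fun z => z) p_infty p_infty), is_lim_id.
      * apply (ex_derive_continuous (fun z => (a * z + b) / (z + 1))). auto_derive. lra.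
Qed.

(** * Speeds along the invariant line *)

(** With w = nu / (1 + nu), this is [E_line] divided by [1 + nu]; [sigma],
    [lam_across] and [lam_along] below are likewise the Rankine-Hugoniot speed
    and the two eigenvalues multiplied by [1 + nu]. *)
Definition red_E (w s : R) : R := s ^ 2 - 2 * w * s + w.
Definition sigma (w u m : R) : R := w * (u + m - 2 * u * m) / (red_E w u * red_E w m).
Definition lam_across (w s : R) : R := 2 * s / red_E w s.
Definition lam_along (w s : R) : R := 2 * w * s * (1 - s) / red_E w s ^ 2.

Lemma red_E_pos w s : 0 < w < 1 -> 0 < red_E w s.
Proof.
  intros Hw. unfold red_E. pose proof (pow2_ge_0 (s - w)). nra.
Qed.

(** The factor left in flux minus chord once the zeros [s = u] and [s = m] are
    divided out; being symmetric in [u], [s], [m], it also measures the gap to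
    the eigenvalue along the line at either end. *)
Definition chord_gap (w u s m : R) : R := u * s + u * m + s * m - 2 * u * s * m - w.

Lemma sigma_sub_sigma w u s m : 0 < w < 1 ->
  sigma w u s - sigma w u m = w * (m - s) * chord_gap w u s m / (red_E w u * red_E w s * red_E w m).
Proof.
  intros Hw. pose proof (red_E_pos w u Hw). pose proof (red_E_pos w s Hw).
  pose proof (red_E_pos w m Hw). unfold sigma, chord_gap, red_E in *. field. lra.
Qed.

(** The case of coinciding arguments in [sigma_sub_sigma]: [lam_along w u] is
    the limit of [sigma w u s] as [s] tends to [u]. *)
Lemma lam_along_sub_sigma w u m : 0 < w < 1 ->
  lam_along w u - sigma w u m = w * (m - u) * chord_gap w u u m / (red_E w u ^ 2 * red_E w m).
Proof.
  intros Hw. pose proof (red_E_pos w u Hw). pose proof (red_E_pos w m Hw).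
  unfold lam_along, sigma, chord_gap, red_E in *. field. lra.
Qed.

Lemma sigma_sym w u m : sigma w u m = sigma w m u.
Proof. unfold sigma. rewrite (Rmult_comm (red_E w u)). f_equal. ring. Qed.

(** * The contact states S and F *)

(** The zero in [u] of the numerator in [sigma_sub_lam_across]. *)
Definition slow_contact (w m : R) : R := w * m / (w * (1 - 2 * m) + 2 * m ^ 2).

Lemma sigma_sub_lam_across w u m : 0 < w < 1 ->
  sigma w u m - lam_across w u
  = (w * m - u * (w * (1 - 2 * m) + 2 * m ^ 2)) / (red_E w u * red_E w m).
Proof.
  intros Hw. pose proof (red_E_pos w u Hw). pose proof (red_E_pos w m Hw).
  unfold lam_across, sigma, red_E in *. field. lra.
Qed.

Definition fast_poly (w m u : R) : R := 2 * m * u ^ 2 - w * (2 * m + 1) * u + m * w.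

Lemma lam_across_sub_sigma w u m : 0 < w < 1 ->
  lam_across w m - sigma w u m = fast_poly w m u / (red_E w u * red_E w m).
Proof.
  intros Hw. pose proof (red_E_pos w u Hw). pose proof (red_E_pos w m Hw).
  unfold lam_across, sigma, fast_poly, red_E in *. field. lra.
Qed.

Lemma lam_along_sub_lam_across w s : 0 < w < 1 ->
  lam_along w s - lam_across w s = 2 * s ^ 2 * (w - s) / red_E w s ^ 2.
Proof.
  intros Hw. pose proof (red_E_pos w s Hw).
  unfold lam_across, lam_along, red_E in *. field. lra.
Qed.

(** The larger of the two roots of [fast_poly w m]. *)
Definition fast_contact (w m : R) : R :=
  (w * (2 * m + 1) + sqrt ((w * (2 * m + 1)) ^ 2 - 8 * m ^ 2 * w)) / (4 * m).

(** This is where the bound 8 comes from: the discriminant divided by [w] is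
    w (2 m + 1)^2 - 8 m^2, whose worst case m = 1 gives 9 w > 8. *)
Lemma fast_disc_pos w m : 8 / 9 < w < 1 -> w < m <= 1 ->
  0 < (w * (2 * m + 1)) ^ 2 - 8 * m ^ 2 * w.
Proof.
  intros Hw Hm.
  assert (0 < w * (2 * m + 1) ^ 2 - 8 * m ^ 2) by nra. nra.
Qed.

(** Writing the second root as the mirror image of the first one in the abscissa
    [w * (2 * m + 1) / (4 * m)] of the vertex makes its position visible. *)
Lemma fast_poly_factor w m u : 8 / 9 < w < 1 -> w < m <= 1 ->
  fast_poly w m u = 2 * m * (u - fast_contact w m)
    * (u - w * (2 * m + 1) / (4 * m) + (fast_contact w m - w * (2 * m + 1) / (4 * m))).
Proof.
  intros Hw Hm. pose proof (fast_disc_pos w m Hw Hm) as Hd.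
  unfold fast_poly, fast_contact.
  pose proof (sqrt_sqrt _ (Rlt_le _ _ Hd)) as Hs.
  set (r := sqrt _) in *.
  transitivity (((4 * m * u - w * (2 * m + 1)) ^ 2 - r * r) / (8 * m)).
  - rewrite Hs. field. lra.
  - field. lra.
Qed.

Lemma fast_contact_gt_vertex w m : 8 / 9 < w < 1 -> w < m <= 1 ->
  w * (2 * m + 1) / (4 * m) < fast_contact w m.
Proof.
  intros Hw Hm. pose proof (sqrt_lt_R0 _ (fast_disc_pos w m Hw Hm)).
  unfold fast_contact. apply Rmult_lt_compat_r; [apply Rinv_0_lt_compat |]; lra.
Qed.

Lemma fast_poly_contact w m : 8 / 9 < w < 1 -> w < m <= 1 ->
  fast_poly w m (fast_contact w m) = 0.
Proof. intros Hw Hm. rewrite fast_poly_factor; trivial. ring. Qed.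

Lemma fast_poly_pos w m u : 8 / 9 < w < 1 -> w < m <= 1 ->
  fast_contact w m < u -> 0 < fast_poly w m u.
Proof.
  intros Hw Hm Hu. rewrite fast_poly_factor; trivial.
  pose proof (fast_contact_gt_vertex w m Hw Hm).
  apply Rmult_lt_0_compat; [apply Rmult_lt_0_compat |]; lra.
Qed.

(** A point where [fast_poly] is positive lies outside the roots; being beyond
    the vertex, it lies beyond the larger one. *)
Lemma fast_contact_lt w m u : 8 / 9 < w < 1 -> w < m <= 1 ->
  w * (2 * m + 1) / (4 * m) < u -> 0 < fast_poly w m u -> fast_contact w m < u.
Proof.
  intros Hw Hm Hu HP. rewrite fast_poly_factor in HP; trivial.
  pose proof (fast_contact_gt_vertex w m Hw Hm).
  destruct (Rlt_le_dec (fast_contact w m) u) as [|Hle]; trivial. exfalso.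
  set (v := w * (2 * m + 1) / (4 * m)) in *.
  assert (0 <= 2 * m * (fast_contact w m - u) * (u - v + (fast_contact w m - v))).
  { apply Rmult_le_pos; [apply Rmult_le_pos |]; lra. }
  nra.
Qed.

(** Holds because [fast_poly w m w = w * (m - w)]. *)
Lemma fast_contact_lt_umbilic w m : 8 / 9 < w < 1 -> w < m <= 1 -> fast_contact w m < w.
Proof.
  intros Hw Hm. apply fast_contact_lt; trivial.
  - apply Rlt_div_l; nra.
  - unfold fast_poly. assert (0 < w * (m - w)) by nra. nra.
Qed.

(** The difference of the two sides is [(2 * m - 1) * (m - w)]. *)
Lemma slow_den_gt w m : 8 / 9 < w < 1 -> w < m <= 1 ->
  m < w * (1 - 2 * m) + 2 * m ^ 2.
Proof.
  intros Hw Hm. assert (0 < (2 * m - 1) * (m - w)) by nra. nra.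
Qed.

Lemma slow_contact_lt_umbilic w m : 8 / 9 < w < 1 -> w < m <= 1 -> slow_contact w m < w.
Proof.
  intros Hw Hm. pose proof (slow_den_gt w m Hw Hm).
  apply Rlt_div_l; nra.
Qed.

(** The interval of admissible left states is not empty: after clearing the
    denominator of [slow_contact], the value of [fast_poly] there factors
    completely, with a factor [m - w]. *)
Lemma fast_contact_lt_slow_contact w m : 8 / 9 < w < 1 -> w < m <= 1 ->
  fast_contact w m < slow_contact w m.
Proof.
  intros Hw Hm. pose proof (slow_den_gt w m Hw Hm) as Hd.
  apply fast_contact_lt; trivial; unfold slow_contact.
  - apply Rlt_0_minus.
    replace (_ - _) with
      (w * (2 * m - 1) * (w * (2 * m + 1) - 2 * m ^ 2)
       / (4 * m * (w * (1 - 2 * m) + 2 * m ^ 2))) by (field; lra).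
    apply Rdiv_lt_0_compat; [apply Rmult_lt_0_compat |]; nra.
  - replace (fast_poly _ _ _) with
      (4 * m ^ 2 * w * (m - w) * (m ^ 2 - (2 * m - 1) * w)
       / (w * (1 - 2 * m) + 2 * m ^ 2) ^ 2)
      by (unfold fast_poly; field; lra).
    assert (0 < m ^ 2 - (2 * m - 1) * w) by nra.
    apply Rdiv_lt_0_compat; [| nra].
    repeat apply Rmult_lt_0_compat; nra.
Qed.

(** [m * fast_poly w 1 b - fast_poly w m b = w * b * (1 - m)], so [fast_poly w m]
    is nonpositive at a root of [fast_poly w 1]. *)
Lemma fast_contact_at_end w m b : 8 / 9 < w < 1 -> w < m <= 1 -> 0 <= b ->
  fast_poly w 1 b = 0 -> b <= fast_contact w m.
Proof.
  intros Hw Hm Hb Hb2. destruct (Rle_lt_dec b (fast_contact w m)) as [|Hlt]; trivial.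
  pose proof (fast_poly_pos w m b Hw Hm Hlt) as HP. unfold fast_poly in *.
  assert (0 <= w * b * (1 - m)) by (repeat apply Rmult_le_pos; lra). nra.
Qed.

(** Positivity of [fast_poly w m u] reads w < 2 m u^2 / ((2 m + 1) u - m), while
    positivity of [chord_gap w u u m] reads w < 2 u m + u^2 - 2 u^2 m.  The second
    bound minus the first is u ((2 m + 1) u - 2 m) (m - (2 m - 1) u) over
    (2 m + 1) u - m, which is positive because the vertex of [fast_poly] is
    already beyond 2 m / (2 m + 1). *)
Lemma chord_gap_pos w m u : 8 / 9 < w < 1 -> w < m <= 1 ->
  fast_contact w m < u < w -> 0 < chord_gap w u u m.
Proof.
  intros Hw Hm [HF Huw].
  pose proof (fast_poly_pos w m u Hw Hm HF) as HP.
  pose proof (fast_contact_gt_vertex w m Hw Hm) as Hv.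
  assert (H4 : w * (2 * m + 1) < 4 * m * u).
  { apply Rmult_lt_reg_r with (/ (4 * m)); [apply Rinv_0_lt_compat; lra |].
    replace (4 * m * u * / (4 * m)) with u by (field; lra). unfold Rdiv in Hv. lra. }
  assert (Hu : 2 * m < u * (2 * m + 1)).
  { assert (8 * m ^ 2 < w * (2 * m + 1) ^ 2) by nra.
    assert (w * (2 * m + 1) * (2 * m + 1) < 4 * m * u * (2 * m + 1)) by nra.
    nra. }
  assert (Hk : 0 < u * ((u * (2 * m + 1) - 2 * m) * (m - (2 * m - 1) * u))).
  { repeat apply Rmult_lt_0_compat; nra. }
  (* [(2 * m + 1) * u - m] times [chord_gap w u u m] is [fast_poly w m u] plus the
     product in [Hk]. *)
  assert (Hden : 0 < (2 * m + 1) * u - m) by lra.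
  unfold chord_gap, fast_poly in *.
  apply Rmult_lt_reg_r with (1 := Hden). nra.
Qed.

(** Its slope in [s] is u (1 - m) + m (1 - u). *)
Lemma chord_gap_increasing w u s t m : 0 <= u <= 1 -> 0 <= m <= 1 -> s <= t ->
  chord_gap w u s m <= chord_gap w u t m.
Proof.
  intros Hu Hm Hst. unfold chord_gap.
  assert (0 <= (t - s) * (u * (1 - m) + m * (1 - u))); [| nra].
  assert (0 <= u * (1 - m)) by nra. assert (0 <= m * (1 - u)) by nra. nra.
Qed.

(** * Eigenvalues of DF on the invariant line *)

Definition scaled_sat (mu : phase -> R) (U : state) (i : phase) : R := sat U i / mu i.
Definition mobility (mu : phase -> R) (U : state) : R :=
  sat U water ^ 2 / mu water + sat U oil ^ 2 / mu oil + sat U gas ^ 2 / mu gas.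

Lemma mobility_pos mu U : (forall i, 0 < mu i) -> 0 < mobility mu U.
Proof.
  intros Hmu. unfold mobility. destruct U as [x y]; simpl sat.
  assert (H : forall i z, 0 <= z ^ 2 / mu i).
  { intros i z. apply Rdiv_le_0_compat; [apply pow2_ge_0 | apply Hmu]. }
  assert (H' : forall i z, z <> 0 -> 0 < z ^ 2 / mu i).
  { intros i z Hz. apply Rdiv_lt_0_compat; [apply pow2_gt_0, Hz | apply Hmu]. }
  pose proof (H water x). pose proof (H oil y). pose proof (H gas (1 - x - y)).
  destruct (Req_dec x 0) as [Hx | Hx]; [| pose proof (H' water x Hx); lra].
  destruct (Req_dec y 0) as [Hy | Hy]; [| pose proof (H' oil y Hy); lra].
  assert (Hz : 1 - x - y <> 0) by lra. pose proof (H' gas _ Hz). lra.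
Qed.

Lemma mobility_eq mu U : (forall i, 0 < mu i) ->
  mobility mu U = sat U water * scaled_sat mu U water
    + sat U oil * scaled_sat mu U oil + sat U gas * scaled_sat mu U gas.
Proof.
  intros Hmu. unfold mobility, scaled_sat. pose proof (Hmu water).
  pose proof (Hmu oil). pose proof (Hmu gas). field. lra.
Qed.

Lemma flux_eq mu U i : (forall i, 0 < mu i) ->
  flux mu i U = sat U i * scaled_sat mu U i / mobility mu U.
Proof.
  intros Hmu. pose proof (mobility_pos mu U Hmu). pose proof (Hmu i).
  unfold flux, scaled_sat. fold (mobility mu U). field. lra.
Qed.

Lemma flux_derivatives mu U i : (forall i, 0 < mu i) ->
  d_w (flux mu i) U = 2 / mobility mu U *
    (scaled_sat mu U i * (match i with water => 1 | oil => 0 | gas => -1 end)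
     - flux mu i U * (scaled_sat mu U water - scaled_sat mu U gas)) /\
  d_o (flux mu i) U = 2 / mobility mu U *
    (scaled_sat mu U i * (match i with water => 0 | oil => 1 | gas => -1 end)
     - flux mu i U * (scaled_sat mu U oil - scaled_sat mu U gas)).
Proof.
  intros Hmu. pose proof (mobility_pos mu U Hmu) as HD.
  pose proof (Hmu water). pose proof (Hmu oil). pose proof (Hmu gas).
  destruct U as [x y].
  unfold mobility in HD; simpl in HD.
  assert (Hne : forall D, D = mobility mu (x, y) -> D <> 0).
  { intros D ->. unfold mobility; simpl. lra. }
  assert (HN : y ^ 2 * mu water * mu gas + x ^ 2 * mu oil * mu gas
               + (1 - x - y) ^ 2 * mu water * mu oil <> 0).
  { intros HN. apply (Hne _ eq_refl). unfold mobility; simpl sat.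
    transitivity ((y ^ 2 * mu water * mu gas + x ^ 2 * mu oil * mu gas
               + (1 - x - y) ^ 2 * mu water * mu oil) / (mu water * mu oil * mu gas));
     [field; lra | rewrite HN; field; lra]. }
  split; apply is_derive_unique; unfold flux, scaled_sat, mobility; destruct i; simpl sat;
    simpl fst; simpl snd;
    (auto_derive; [repeat split; trivial; apply Hne; unfold mobility; simpl; field; lra
                  | field; repeat split; try lra; intros Hz; apply HN; nra]).
Qed.

(** For the three saturations taken as independent variables, the Jacobian is
    J = (2 / D) (diag a - f a^T), where a is [scaled_sat], f the flux and D the
    [mobility].  Its columns sum to zero, so passing to the two-dimensional
    Jacobian removes an eigenvalue 0: the trace is that of J, and the
    determinant is the sum of the principal 2 x 2 minors of J.  Hence the
    expressions symmetric in the three phases here and in [detDF_eq]. *)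
Lemma trDF_eq mu U : (forall i, 0 < mu i) ->
  trDF mu U = 2 / mobility mu U *
    (scaled_sat mu U water + scaled_sat mu U oil + scaled_sat mu U gas
     - (sat U water * scaled_sat mu U water ^ 2 + sat U oil * scaled_sat mu U oil ^ 2
        + sat U gas * scaled_sat mu U gas ^ 2) / mobility mu U).
Proof.
  intros Hmu. pose proof (mobility_pos mu U Hmu) as HD. unfold trDF.
  destruct (flux_derivatives mu U water Hmu) as [-> _].
  destruct (flux_derivatives mu U oil Hmu) as [_ ->].
  rewrite !flux_eq by trivial. pose proof (mobility_eq mu U Hmu) as Hs.
  apply Rmult_eq_reg_r with (mobility mu U ^ 2); [| apply pow_nonzero; lra].
  transitivity (2 * (mobility mu U * (scaled_sat mu U water + scaled_sat mu U oil)
     - sat U water * scaled_sat mu U water * (scaled_sat mu U water - scaled_sat mu U gas)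
     - sat U oil * scaled_sat mu U oil * (scaled_sat mu U oil - scaled_sat mu U gas)));
    [field; lra |].
  transitivity (2 * (mobility mu U
       * (scaled_sat mu U water + scaled_sat mu U oil + scaled_sat mu U gas)
     - (sat U water * scaled_sat mu U water ^ 2 + sat U oil * scaled_sat mu U oil ^ 2
        + sat U gas * scaled_sat mu U gas ^ 2))); [| field; lra].
  rewrite Hs. ring.
Qed.

(** The minor of J on two phases is (4 / D^2) times the product of their scaled
    saturations and of the flux of the third phase. *)
Lemma detDF_eq mu U : (forall i, 0 < mu i) ->
  detDF mu U
  = 4 * scaled_sat mu U water * scaled_sat mu U oil * scaled_sat mu U gas / mobility mu U ^ 3.
Proof.
  intros Hmu. pose proof (mobility_pos mu U Hmu) as HD. unfold detDF.
  destruct (flux_derivatives mu U water Hmu) as [-> ->].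
  destruct (flux_derivatives mu U oil Hmu) as [-> ->].
  rewrite !flux_eq by trivial. pose proof (mobility_eq mu U Hmu) as Hs.
  set (D := mobility mu U) in *.
  set (p := scaled_sat mu U water) in *. set (q := scaled_sat mu U oil) in *.
  set (r := scaled_sat mu U gas) in *.
  transitivity (4 * p * q * (D - sat U water * (p - r) - sat U oil * (q - r)) / D ^ 3);
    [field; lra |].
  replace (D - _ - _) with r; [field; lra |].
  rewrite Hs. simpl. ring.
Qed.

Definition vertex (c : phase) : state :=
  match c with water => (1, 0) | oil => (0, 1) | gas => (0, 0) end.

Definition line_state (mu : phase -> R) (c : phase) (s : R) : state :=
  ((1 - s) * fst (vertex c) + s * fst (end_point mu c),
   (1 - s) * snd (vertex c) + s * snd (end_point mu c)).

Lemma on_line_bounds mu c U : on_line mu c U -> 0 <= eff c U <= 1.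
Proof.
  intros [HT _]. pose proof (HT water). pose proof (HT oil). pose proof (HT gas).
  destruct c; unfold eff; simpl in *; lra.
Qed.

Lemma line_state_on_line mu c s : (forall i, 0 < mu i) -> 0 <= s <= 1 ->
  on_line mu c (line_state mu c s) /\ eff c (line_state mu c s) = s.
Proof.
  intros Hmu Hs. destruct (end_point_on_line mu c Hmu) as [[HT HL] He].
  assert (Hsat : forall i, sat (line_state mu c s) i
            = (1 - s) * sat (vertex c) i + s * sat (end_point mu c) i).
  { intros [| |]; simpl; ring. }
  assert (Hv : forall i, 0 <= sat (vertex c) i) by (intros i; destruct c, i; simpl; lra).
  assert (Hva : sat (vertex c) (phase_a c) = 0) by (destruct c; simpl; ring).
  assert (Hvb : sat (vertex c) (phase_b c) = 0) by (destruct c; simpl; ring).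
  split; [split |].
  - intros i. rewrite Hsat. pose proof (Hv i). pose proof (HT i). nra.
  - rewrite !Hsat, Hva, Hvb. unfold Rdiv in *.
    rewrite !Rmult_0_r, !Rplus_0_l, !Rmult_assoc, HL. reflexivity.
  - unfold eff in *. rewrite !Hsat, Hva, Hvb.
    transitivity (s * (sat (end_point mu c) (phase_a c) + sat (end_point mu c) (phase_b c)));
      [ring | rewrite He; ring].
Qed.

Lemma on_line_eq_line_state mu c U : (forall i, 0 < mu i) -> on_line mu c U ->
  U = line_state mu c (eff c U).
Proof.
  intros Hmu HU. destruct (flux_line mu c U Hmu HU) as [_ Hi].
  destruct (Hi _ (or_introl eq_refl)) as [Ha _].
  destruct (Hi _ (or_intror eq_refl)) as [Hb _].
  destruct U as [x y]. unfold line_state.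
  destruct c; simpl in *; f_equal; unfold eff in *; simpl in *; lra.
Qed.

Lemma scaled_sat_on_line mu c U : (forall i, 0 < mu i) -> on_line mu c U ->
  let T := mu (phase_a c) + mu (phase_b c) in
  scaled_sat mu U (phase_a c) = eff c U / T /\ scaled_sat mu U (phase_b c) = eff c U / T /\
  scaled_sat mu U c = nu mu c * (1 - eff c U) / T /\ sat U c = 1 - eff c U /\
  mobility mu U = E_line mu c (eff c U) / T.
Proof.
  intros Hmu HU T. destruct (flux_line mu c U Hmu HU) as [_ Hi].
  destruct (Hi _ (or_introl eq_refl)) as [Ha _].
  destruct (Hi _ (or_intror eq_refl)) as [Hb _].
  pose proof (Hmu (phase_a c)). pose proof (Hmu (phase_b c)). pose proof (Hmu c).
  assert (Hc : sat U c = 1 - eff c U) by (destruct c; unfold eff; simpl; ring).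
  unfold scaled_sat. rewrite Hc, Ha, Hb. unfold T, nu, E_line, nu.
  repeat split; try (field; lra).
  transitivity (sat U (phase_a c) ^ 2 / mu (phase_a c)
      + sat U (phase_b c) ^ 2 / mu (phase_b c) + sat U c ^ 2 / mu c).
  - unfold mobility. destruct c; simpl; ring.
  - rewrite Ha, Hb, Hc. field. lra.
Qed.

Lemma eff_umbilic mu c : (forall i, 0 < mu i) -> eff c (umbilic mu) = nu mu c / (1 + nu mu c).
Proof.
  intros Hmu. pose proof (Hmu water). pose proof (Hmu oil). pose proof (Hmu gas).
  destruct c; unfold eff, nu; simpl; field; lra.
Qed.

Lemma nu_pos mu c : (forall i, 0 < mu i) -> 0 < nu mu c.
Proof.
  intros Hmu. pose proof (Hmu (phase_a c)). pose proof (Hmu (phase_b c)).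
  apply Rdiv_lt_0_compat; [lra | apply Hmu].
Qed.

Lemma E_line_eq mu c s : (forall i, 0 < mu i) ->
  E_line mu c s = (1 + nu mu c) * red_E (eff c (umbilic mu)) s.
Proof.
  intros Hmu. pose proof (nu_pos mu c Hmu). rewrite eff_umbilic by trivial.
  unfold E_line, red_E. field. lra.
Qed.

Lemma eff_umbilic_bounds mu c : (forall i, 0 < mu i) -> 0 < eff c (umbilic mu) < 1.
Proof.
  intros Hmu. pose proof (nu_pos mu c Hmu). rewrite eff_umbilic by trivial.
  split; [apply Rdiv_lt_0_compat | apply Rlt_div_l]; lra.
Qed.

Lemma rh_speed_eq mu c M N : (forall i, 0 < mu i) ->
  rh_speed mu c M N = sigma (eff c (umbilic mu)) (eff c M) (eff c N) / (1 + nu mu c).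
Proof.
  intros Hmu. pose proof (nu_pos mu c Hmu). pose proof (eff_umbilic_bounds mu c Hmu) as Hw.
  unfold rh_speed, sigma. rewrite !E_line_eq by trivial.
  replace (nu mu c) with ((1 + nu mu c) * eff c (umbilic mu)) at 1
    by (rewrite eff_umbilic by trivial; field; lra).
  pose proof (red_E_pos _ (eff c M) Hw). pose proof (red_E_pos _ (eff c N) Hw).
  field. lra.
Qed.

(** Instead of exhibiting eigenvectors, trace and determinant are identified
    with the sum and the product of the two candidate eigenvalues; the
    discriminant is then the square of their difference. *)
Lemma char_poly_on_line mu c U : (forall i, 0 < mu i) -> on_line mu c U ->
  let w := eff c (umbilic mu) in let K := 1 + nu mu c in
  trDF mu U = lam_along w (eff c U) / K + lam_across w (eff c U) / K /\
  discDF mu U = (lam_along w (eff c U) / K - lam_across w (eff c U) / K) ^ 2.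
Proof.
  intros Hmu HU w K.
  pose proof (nu_pos mu c Hmu). pose proof (eff_umbilic_bounds mu c Hmu) as Hw.
  pose proof (Hmu (phase_a c)) as H1. pose proof (Hmu (phase_b c)) as H2.
  destruct (scaled_sat_on_line mu c U Hmu HU) as (Ha & Hb & Hc & Hsc & HD).
  destruct (flux_line mu c U Hmu HU) as [_ Hi].
  destruct (Hi _ (or_introl eq_refl)) as [Hsa _].
  destruct (Hi _ (or_intror eq_refl)) as [Hsb _].
  rewrite E_line_eq in HD by trivial. fold w K in HD. fold w in Hw.
  assert (Hnu : nu mu c = K * w)
    by (unfold w, K; rewrite eff_umbilic by trivial; field; lra).
  rewrite Hnu in Hc. pose proof (red_E_pos w (eff c U) Hw) as He.
  assert (HK : 0 < K) by (unfold K; lra).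
  set (T := mu (phase_a c) + mu (phase_b c)) in *. assert (HT : 0 < T) by (unfold T; lra).
  set (s := eff c U) in *.
  assert (Htr : trDF mu U = lam_along w s / K + lam_across w s / K).
  { rewrite trDF_eq by trivial.
    transitivity (2 / mobility mu U *
      (scaled_sat mu U (phase_a c) + scaled_sat mu U (phase_b c) + scaled_sat mu U c
       - (sat U (phase_a c) * scaled_sat mu U (phase_a c) ^ 2
          + sat U (phase_b c) * scaled_sat mu U (phase_b c) ^ 2
          + sat U c * scaled_sat mu U c ^ 2) / mobility mu U)).
    { destruct c; simpl; f_equal; unfold Rdiv; ring. }
    assert (Hk : K * (1 - w) = 1) by (unfold K, w; rewrite eff_umbilic by trivial; field; lra).
    (* For a, a, b the scaled saturations, D = s a + (1 - s) b; therefore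
       s a^2 + (1 - s) b^2 = (a + b) D - a b. *)
    assert (HD' : mobility mu U = s * (s / T) + (1 - s) * (K * w * (1 - s) / T)).
    { rewrite HD. transitivity ((K * w * (1 - s) ^ 2 + K * (1 - w) * s ^ 2) / T);
        [unfold red_E; field; lra | rewrite Hk; field; lra]. }
    replace (_ + _ + sat U c * _) with
      ((s / T + K * w * (1 - s) / T) * mobility mu U - s / T * (K * w * (1 - s) / T)).
    2:{ rewrite HD', Ha, Hb, Hc, Hsa, Hsb, Hsc. unfold T. field. unfold T in HT. lra. }
    rewrite Ha, Hb, Hc, HD. unfold lam_along, lam_across. field. lra. }
  split; trivial.
  unfold discDF. rewrite Htr, detDF_eq by trivial.
  replace (4 * scaled_sat mu U water * scaled_sat mu U oil * scaled_sat mu U gas) with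
    (4 * scaled_sat mu U (phase_a c) * scaled_sat mu U (phase_b c) * scaled_sat mu U c)
    by (destruct c; simpl; ring).
  rewrite HD, Ha, Hb, Hc. unfold lam_along, lam_across. field. lra.
Qed.

Lemma lambda_below_umbilic mu c U : (forall i, 0 < mu i) -> on_line mu c U ->
  eff c U < eff c (umbilic mu) ->
  lambda_s mu U = lam_across (eff c (umbilic mu)) (eff c U) / (1 + nu mu c) /\
  lambda_f mu U = lam_along (eff c (umbilic mu)) (eff c U) / (1 + nu mu c).
Proof.
  intros Hmu HU Hlt. destruct (char_poly_on_line mu c U Hmu HU) as [Ht Hd].
  pose proof (nu_pos mu c Hmu). pose proof (eff_umbilic_bounds mu c Hmu) as Hw.
  pose proof (lam_along_sub_lam_across _ (eff c U) Hw) as Hs.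
  pose proof (red_E_pos _ (eff c U) Hw) as He.
  assert (0 < red_E (eff c (umbilic mu)) (eff c U) ^ 2) by (apply pow_lt, He).
  pose proof (pow2_ge_0 (eff c U)).
  assert (0 <= lam_along (eff c (umbilic mu)) (eff c U) / (1 + nu mu c)
          - lam_across (eff c (umbilic mu)) (eff c U) / (1 + nu mu c)).
  { unfold Rdiv. rewrite <- Rmult_minus_distr_r, Hs.
    apply Rdiv_le_0_compat; [apply Rdiv_le_0_compat; nra | lra]. }
  unfold lambda_s, lambda_f. rewrite Hd, sqrt_pow2, Ht by trivial. split; field; lra.
Qed.

Lemma lambda_above_umbilic mu c U : (forall i, 0 < mu i) -> on_line mu c U ->
  eff c (umbilic mu) < eff c U ->
  lambda_s mu U = lam_along (eff c (umbilic mu)) (eff c U) / (1 + nu mu c) /\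
  lambda_f mu U = lam_across (eff c (umbilic mu)) (eff c U) / (1 + nu mu c).
Proof.
  intros Hmu HU Hlt. destruct (char_poly_on_line mu c U Hmu HU) as [Ht Hd].
  pose proof (nu_pos mu c Hmu). pose proof (eff_umbilic_bounds mu c Hmu) as Hw.
  pose proof (lam_along_sub_lam_across _ (eff c U) Hw) as Hs.
  pose proof (red_E_pos _ (eff c U) Hw) as He.
  assert (0 < red_E (eff c (umbilic mu)) (eff c U) ^ 2) by (apply pow_lt, He).
  pose proof (pow2_ge_0 (eff c U)).
  assert (0 <= lam_across (eff c (umbilic mu)) (eff c U) / (1 + nu mu c)
          - lam_along (eff c (umbilic mu)) (eff c U) / (1 + nu mu c)).
  { unfold Rdiv. rewrite <- Rmult_minus_distr_r, <- Ropp_minus_distr, Hs.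
    replace (- _) with (2 * eff c U ^ 2 * (eff c U - eff c (umbilic mu))
                        / red_E (eff c (umbilic mu)) (eff c U) ^ 2) by (field; lra).
    apply Rdiv_le_0_compat; [apply Rdiv_le_0_compat; nra | lra]. }
  unfold lambda_s, lambda_f. rewrite Hd, <- Rsqr_pow2, Rsqr_neg_minus, Rsqr_pow2,
    sqrt_pow2, Ht by trivial. split; field; lra.
Qed.

(** * The undercompressive shocks *)

(** nu^2 - nu_minus^2 = 4 mu_a mu_b / mu_c^2. *)
Lemma nu_gt_8 mu c : (forall i, 0 < mu i) ->
  8 < nu mu c \/ 8 < nu_minus mu c ^ 2 / nu mu c -> 8 < nu mu c.
Proof.
  intros Hmu [H | H]; trivial. pose proof (nu_pos mu c Hmu) as Hn.
  assert (Hle : nu_minus mu c ^ 2 <= nu mu c ^ 2).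
  { pose proof (Hmu (phase_a c)). pose proof (Hmu (phase_b c)). pose proof (Hmu c).
    apply Rminus_le_0.
    replace (_ - _) with (4 * mu (phase_a c) * mu (phase_b c) / mu c ^ 2)
      by (unfold nu, nu_minus; field; lra).
    apply Rdiv_le_0_compat; [| apply pow_lt; trivial].
    repeat apply Rmult_le_pos; lra. }
  apply Rlt_div_r in H; trivial. nra.
Qed.

Lemma eff_umbilic_gt mu c : (forall i, 0 < mu i) -> 8 < nu mu c ->
  8 / 9 < eff c (umbilic mu) < 1.
Proof.
  intros Hmu Hn. rewrite eff_umbilic by trivial.
  split; [apply (proj1 (Rlt_div_r _ _ (1 + nu mu c) ltac:(lra))) | apply Rlt_div_l]; lra.
Qed.

(** The speed separates the two eigenvalues at both ends, so both states are
    saddles of the travelling wave equation. *)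
Lemma lax_inequalities w m u : 8 / 9 < w < 1 -> w < m <= 1 ->
  fast_contact w m < u < slow_contact w m ->
  lam_across w u < sigma w u m < lam_along w u /\
  lam_along w m < sigma w u m < lam_across w m.
Proof.
  intros Hw Hm [HF HS].
  assert (Hw' : 0 < w < 1) by lra.
  pose proof (slow_contact_lt_umbilic w m Hw Hm) as HSw.
  pose proof (fast_contact_gt_vertex w m Hw Hm) as Hv.
  assert (0 < w * (2 * m + 1) / (4 * m)) by (apply Rdiv_lt_0_compat; nra).
  pose proof (red_E_pos w u Hw') as Heu. pose proof (red_E_pos w m Hw') as Hem.
  assert (Heum : 0 < red_E w u * red_E w m) by nra.
  pose proof (chord_gap_pos w m u Hw Hm ltac:(lra)) as Hc.
  pose proof (chord_gap_increasing w u u m m ltac:(lra) ltac:(lra) ltac:(lra)) as Hc'.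
  repeat split; apply Rlt_0_minus.
  - rewrite sigma_sub_lam_across by trivial. apply Rdiv_lt_0_compat; trivial.
    pose proof (slow_den_gt w m Hw Hm).
    unfold slow_contact in HS. apply Rlt_div_r in HS; lra.
  - rewrite lam_along_sub_sigma by trivial.
    apply Rdiv_lt_0_compat; [repeat apply Rmult_lt_0_compat; lra |].
    apply Rmult_lt_0_compat; [apply pow_lt |]; trivial.
  - rewrite sigma_sym, <- Ropp_minus_distr, lam_along_sub_sigma by trivial.
    replace (- _) with (w * (m - u) * chord_gap w u m m / (red_E w m ^ 2 * red_E w u))
      by (unfold chord_gap; field; lra).
    apply Rdiv_lt_0_compat; [repeat apply Rmult_lt_0_compat; lra |].
    apply Rmult_lt_0_compat; [apply pow_lt |]; trivial.
  - rewrite lam_across_sub_sigma by trivial. apply Rdiv_lt_0_compat; trivial.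
    apply fast_poly_pos; trivial.
Qed.

(** By the Rankine-Hugoniot relation between [U] and a point X of the line,
    F(X) - F(U) - sg (X - U) = (sigma(U; X) - sg) (X - U): the line is
    invariant, and the travelling wave equation on it is a scalar equation with
    velocity (s - a) (b - s) k(s), where [k] is positive by [chord_gap]. *)
Lemma line_profile mu c U M : (forall i, 0 < mu i) -> on_line mu c U -> on_line mu c M ->
  eff c U < eff c M ->
  0 < chord_gap (eff c (umbilic mu)) (eff c U) (eff c U) (eff c M) ->
  viscous_profile mu U M (rh_speed mu c U M).
Proof.
  intros Hmu HU HM Hlt Hc.
  set (w := eff c (umbilic mu)) in *.
  set (a := eff c U) in *. set (b := eff c M) in *.
  pose proof (nu_pos mu c Hmu) as Hnu. pose proof (eff_umbilic_bounds mu c Hmu) as Hw.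
  fold w in Hw.
  pose proof (on_line_bounds mu c U HU) as Ha. pose proof (on_line_bounds mu c M HM) as Hb.
  fold a in Ha. fold b in Hb.
  set (k := fun s => w * chord_gap w a s b / (red_E w a * red_E w s * red_E w b) / (1 + nu mu c)).
  assert (He : forall s, 0 < red_E w s) by (intros s; apply red_E_pos, Hw).
  destruct (heteroclinic_orbit_exists k a b Hlt) as (s & Hab & Hds & Hm & Hp).
  - intros x _. apply (ex_derive_continuous k). unfold k, chord_gap, red_E.
    pose proof (He a). pose proof (He b). pose proof (He x). unfold red_E in *.
    auto_derive.
    apply Rgt_not_eq. repeat apply Rmult_lt_0_compat; lra.
  - intros x Hx. unfold k. pose proof (He a). pose proof (He b). pose proof (He x).
    pose proof (chord_gap_increasing w a a x b ltac:(lra) ltac:(lra) ltac:(lra)).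
    repeat apply Rdiv_lt_0_compat; try lra; repeat apply Rmult_lt_0_compat; lra.
  - assert (Hline : forall t, on_line mu c (line_state mu c (s t))
                              /\ eff c (line_state mu c (s t)) = s t).
    { intros t. apply line_state_on_line; trivial. pose proof (Hab t). lra. }
    assert (HUe := on_line_eq_line_state mu c U Hmu HU).
    assert (HMe := on_line_eq_line_state mu c M Hmu HM).
    fold a in HUe. fold b in HMe.
    assert (Hspeed : forall t, (rh_speed mu c U (line_state mu c (s t)) - rh_speed mu c U M)
              = (b - s t) * k (s t)).
    { intros t. rewrite !rh_speed_eq by trivial. rewrite (proj2 (Hline t)).
      fold w a b. unfold Rdiv. rewrite <- Rmult_minus_distr_r, sigma_sub_sigma by trivial.
      unfold k, Rdiv. ring. }
    exists (fun t => fst (line_state mu c (s t))), (fun t => snd (line_state mu c (s t))).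
    assert (Hlim : forall (p q : R) (x : Rbar) (l : R), is_lim s x l ->
              is_lim (fun t => (1 - s t) * p + s t * q) x ((1 - l) * p + l * q)).
    { intros p q x l Hl.
      apply (is_lim_comp_continuous s (fun z => (1 - z) * p + z * q) x l Hl).
      apply (ex_derive_continuous (fun z => (1 - z) * p + z * q)). auto_derive. trivial. }
    assert (Hder : forall t p q,
              is_derive (fun t => (1 - s t) * p + s t * q) t
                ((s t - a) * (b - s t) * k (s t) * (q - p))).
    { intros t p q. specialize (Hds t).
      auto_derive; [repeat split; eexists; apply Hds |].
      replace (Derive (fun x => s x) t) with (Derive s t) by reflexivity.
      rewrite (is_derive_unique _ _ _ Hds). ring. }
    split; [| split; [| split; [| split; [| split; [| split]]]]].
    + intros t. rewrite <- surjective_pairing. apply (Hline t).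
    + intros t. cbv beta. rewrite <- surjective_pairing.
      destruct (rh_speedP mu c U _ Hmu HU (proj1 (Hline t))) as [-> _].
      rewrite <- Rmult_minus_distr_r, Hspeed.
      replace (_ * _) with ((s t - a) * (b - s t) * k (s t)
                            * (fst (end_point mu c) - fst (vertex c)));
        [apply Hder |].
      rewrite (f_equal fst HUe). unfold line_state, fst. ring.
    + intros t. cbv beta. rewrite <- surjective_pairing.
      destruct (rh_speedP mu c U _ Hmu HU (proj1 (Hline t))) as [_ ->].
      rewrite <- Rmult_minus_distr_r, Hspeed.
      replace (_ * _) with ((s t - a) * (b - s t) * k (s t)
                            * (snd (end_point mu c) - snd (vertex c)));
        [apply Hder |].
      rewrite (f_equal snd HUe). unfold line_state, snd. ring.
    + rewrite HUe. apply Hlim, Hm.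
    + rewrite HUe. apply Hlim, Hm.
    + rewrite HMe. apply Hlim, Hp.
    + rewrite HMe. apply Hlim, Hp.
Qed.

Lemma fast_contact_iff mu c U M : (forall i, 0 < mu i) -> on_line mu c M ->
  eff c (umbilic mu) < eff c M ->
  (rh_speed mu c U M = lambda_f mu M <->
   fast_poly (eff c (umbilic mu)) (eff c M) (eff c U) = 0).
Proof.
  intros Hmu HM Hlt. destruct (lambda_above_umbilic mu c M Hmu HM Hlt) as [_ ->].
  rewrite rh_speed_eq by trivial.
  pose proof (nu_pos mu c Hmu) as Hnu. pose proof (eff_umbilic_bounds mu c Hmu) as Hw.
  pose proof (lam_across_sub_sigma _ (eff c U) (eff c M) Hw) as H.
  pose proof (red_E_pos _ (eff c U) Hw). pose proof (red_E_pos _ (eff c M) Hw).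
  set (A := lam_across _ _) in *. set (B := sigma _ _ _) in *.
  set (P := fast_poly _ _ _) in *.
  set (x := red_E _ (eff c U)) in *. set (y := red_E _ (eff c M)) in *.
  split; intros Heq.
  - assert (B = A) by (apply Rmult_eq_reg_r with (/ (1 + nu mu c));
      [exact Heq | apply Rinv_neq_0_compat; lra]).
    transitivity (P / (x * y) * (x * y)); [field; lra |]. rewrite <- H. nra.
  - rewrite Heq in H. unfold Rdiv in H. rewrite Rmult_0_l in H.
    replace B with A by lra. reflexivity.
Qed.

Theorem corollary5p1 :
  forall (mu : phase -> R) (c : phase),
    (forall i, 0 < mu i) ->
    (8 < nu mu c \/ 8 < nu_minus mu c ^ 2 / nu mu c) ->
    (exists B2 : state,
       on_line mu c B2 /\
       rh_speed mu c B2 (end_point mu c) = lambda_f mu (end_point mu c)) /\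
    forall M : state,
      on_line mu c M ->
      eff c (umbilic mu) < eff c M <= 1 ->
      exists S F : state,
        (on_line mu c S /\ eff c S < eff c (umbilic mu)) /\
        (on_line mu c F /\ eff c F < eff c (umbilic mu)) /\
        eff c F < eff c S /\
        (forall U : state,
           on_line mu c U ->
           eff c F < eff c U < eff c S ->
           undercompressive_shock mu U M (rh_speed mu c U M)) /\
        rh_speed mu c S M = lambda_s mu S /\
        rh_speed mu c F M = lambda_f mu M /\
        (forall B2 : state,
           on_line mu c B2 ->
           rh_speed mu c B2 (end_point mu c) = lambda_f mu (end_point mu c) ->
           eff c B2 <= eff c F).
Proof.
  intros mu c Hmu Hnu8. apply nu_gt_8 in Hnu8; trivial.
  pose proof (eff_umbilic_gt mu c Hmu Hnu8) as Hw.
  destruct (end_point_on_line mu c Hmu) as [HE HE1].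
  set (w := eff c (umbilic mu)) in *.
  assert (HF0 : forall m, w < m <= 1 -> 0 < fast_contact w m < w).
  { intros m Hm. pose proof (fast_contact_gt_vertex w m Hw Hm).
    assert (0 < w * (2 * m + 1) / (4 * m)) by (apply Rdiv_lt_0_compat; nra).
    pose proof (fast_contact_lt_umbilic w m Hw Hm). lra. }
  assert (HF : forall M, on_line mu c M -> w < eff c M <= 1 ->
    let F := line_state mu c (fast_contact w (eff c M)) in
    on_line mu c F /\ eff c F = fast_contact w (eff c M) /\
    rh_speed mu c F M = lambda_f mu M).
  { intros M HM Hm F. pose proof (HF0 _ Hm).
    destruct (line_state_on_line mu c (fast_contact w (eff c M)) Hmu ltac:(lra)) as [HF HFe].
    repeat split; try apply HF; trivial.
    apply fast_contact_iff; trivial; [apply Hm |].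
    fold F w in HFe |- *. rewrite HFe. apply fast_poly_contact; trivial. }
  split.
  { destruct (HF _ HE) as (HB & _ & HBs); [lra |]. eexists. split; [apply HB | apply HBs]. }
  intros M HM Hm. set (m := eff c M) in *.
  destruct (HF M HM Hm) as (HFl & HFe & HFs). fold m in HFl, HFe, HFs.
  pose proof (HF0 m Hm) as HFb. pose proof (fast_contact_lt_slow_contact w m Hw Hm) as HFS.
  pose proof (slow_contact_lt_umbilic w m Hw Hm) as HSw.
  destruct (line_state_on_line mu c (slow_contact w m) Hmu ltac:(lra)) as [HS HSe].
  exists (line_state mu c (slow_contact w m)), (line_state mu c (fast_contact w m)).
  rewrite HSe, HFe.
  split; [| split; [| split; [| split; [| split; [| split]]]]]; trivial.
  - split; trivial.
  - split; trivial. lra.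
  - intros U HU Hb.
    destruct (lax_inequalities w m (eff c U) Hw Hm Hb) as [HlU HlM].
    destruct (lambda_below_umbilic mu c U Hmu HU) as [HUs HUf]; [fold w; lra |].
    destruct (lambda_above_umbilic mu c M Hmu HM (proj1 Hm)) as [HMs HMf].
    assert (Hr : forall x y, x < y -> x / (1 + nu mu c) < y / (1 + nu mu c)).
    { intros x y Hxy. apply Rmult_lt_compat_r; [apply Rinv_0_lt_compat |]; lra. }
    split; [apply rh_speedP; trivial |].
    rewrite HUs, HUf, HMs, HMf. fold w m.
    split; [| split].
    + rewrite rh_speed_eq by trivial. split; apply Hr, HlU.
    + rewrite rh_speed_eq by trivial. split; apply Hr, HlM.
    + apply line_profile; trivial; fold w m; [lra |]. apply chord_gap_pos; trivial. lra.
  - destruct (lambda_below_umbilic mu c _ Hmu HS) as [-> _]; [rewrite HSe; trivial |].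
    rewrite rh_speed_eq by trivial. rewrite HSe. fold w m. f_equal.
    apply Rminus_diag_uniq. rewrite sigma_sub_lam_across by lra.
    pose proof (slow_den_gt w m Hw Hm).
    replace (w * m - _) with 0 by (unfold slow_contact; field; lra).
    unfold Rdiv. ring.
  - intros B2 HB HBs. apply (fast_contact_iff mu c B2 _ Hmu HE) in HBs.
    + rewrite HE1 in HBs. apply (fast_contact_at_end w); trivial.
      apply (on_line_bounds mu c B2 HB).
    + rewrite HE1. fold w. lra.
Qed.
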